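(* If the differentiation operator $D$ is bounded on a discrete function space $\mathcal{X}$ on a tree $T$, then \[\sigma_p(D)=\begin{cases}\{0\} & \text{if } \mathcal{X} \text{ contains the constant functions},\\ \emptyset & \text{otherwise.}\end{cases}\]
   Context: A tree $T$ is a locally finite, connected, simply-connected graph, identified with its set of vertices. A vertex is terminal if it has a unique neighbor; all trees are assumed to be without terminal vertices (hence infinite) and rooted at a vertex $o$. For $v\neq o$, $v^-$ denotes the unique neighbor of $v$ lying on the path from $o$ to $v$ (the parent of $v$). A function on $T$ is a complex-valued function on its vertices. The derivative of $f:T\to\mathbb{C}$ is $f'(v)=f(v)-f(v^-)$ for $v\neq o$ and $f'(o)=0$; the differentiation operator is $Df=f'$. A functional Banach space on a set $\Omega$ is a Banach space of complex-valued functions on $\Omega$ with pointwise vector operations, such that $f(x)=g(x)$ for all $x\in\Omega$ implies $f=g$, $f(x)=f(y)$ for every $f$ in the space implies $x=y$, and for each $x\in\Omega$ the linear functional $f\mapsto f(x)$ is continuous. A discrete function space $\mathcal{X}$ on $T$ is a functional Banach space whose elements are functions on $T$, with norm $\|\cdot\|_{\mathcal{X}}$. $D$ is bounded on $\mathcal{X}$ if it is a bounded linear operator from $\mathcal{X}$ to $\mathcal{X}$. $\sigma_p(D)$ denotes the point spectrum, i.e. the set of eigenvalues, of $D$ on $\mathcal{X}$. *)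

(* Defs.v *)
From HB Require Import structures.
From mathcomp Require Import all_boot all_order all_algebra.
From mathcomp Require Import complex.
From mathcomp Require Import all_classical all_reals all_analysis.

Set Implicit Arguments.
Unset Strict Implicit.
Unset Printing Implicit Defensive.

Import Order.TTheory GRing.Theory Num.Theory.
Import numFieldNormedType.Exports.

Local Open Scope classical_set_scope.
Local Open Scope complex_scope.
Local Open Scope ring_scope.

Definition terminal (V : Type) (adj : rel V) (v : V) : Prop :=
  exists! u, adj v u.

(* [tree_simply_connected] says that there is no simple closed walk on three
   or more vertices: for a symmetric relation, [ucycle] also accepts an edge
   traversed back and forth as a cycle of length 2.
   [tree_infinite] only excludes the one-vertex graph, whose vertex has no
   neighbor and is therefore not terminal. *)
Structure rooted_tree : Type := RootedTree {
  vertex :> choiceType;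
  adj : rel vertex;
  root : vertex;
  tree_sym : symmetric adj;
  tree_irr : irreflexive adj;
  tree_locally_finite : forall v, finite_set [set u | adj v u];
  tree_connected : forall u v, exists2 p, path adj u p & last u p = v;
  tree_simply_connected : forall c : seq vertex, ucycle adj c -> (size c <= 2)%N;
  tree_no_terminal : forall v, ~ terminal adj v;
  tree_infinite : infinite_set [set: vertex]
}.

Definition simple_path (T : rooted_tree) (u : T) (p : seq T) (v : T) : Prop :=
  [/\ path (@adj T) u p, uniq (u :: p) & last u p = v].

Definition is_parent (T : rooted_tree) (v u : T) : Prop :=
  adj v u /\ exists2 p, simple_path (root T) p v & u \in root T :: p.

(* At the root no vertex satisfies [is_parent], and [parent] takes the dummy
   value [root T]. *)
Definition parent (T : rooted_tree) (v : T) : T :=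
  xget v [set u | is_parent v u].

Definition derivative (R : realType) (T : rooted_tree) (f : T -> R[i]) (v : T)
    : R[i] :=
  if v == root T then 0 else f v - f (parent v).

(* The elements of the Banach space [fbs_space] are identified with functions
   on [Omega] through [fbs_eval], which is linear (the vector operations are
   pointwise) and injective (a function determines the element). *)
Structure functionalBanachSpace (R : realType) (Omega : Type) : Type :=
  FunctionalBanachSpace {
  fbs_space :> completeNormedModType R[i];
  fbs_eval : fbs_space -> Omega -> R[i];
  fbs_linear : forall (a : R[i]) (f g : fbs_space) (x : Omega),
    fbs_eval (a *: f + g) x = a * fbs_eval f x + fbs_eval g x;
  fbs_ext : forall f g : fbs_space,
    (forall x, fbs_eval f x = fbs_eval g x) -> f = g;
  fbs_separates : forall x y : Omega,
    (forall f, fbs_eval f x = fbs_eval f y) -> x = y;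
  fbs_continuous : forall x : Omega,
    continuous (fun f : fbs_space => (fbs_eval f x : R[i]^o))
}.

Definition discreteFunctionSpace (R : realType) (T : rooted_tree) : Type :=
  functionalBanachSpace R T.

Definition contains_constants (R : realType) (T : rooted_tree)
    (X : discreteFunctionSpace R T) : Prop :=
  forall c : R[i], exists f : X, forall v : T, fbs_eval f v = c.

Definition is_differentiation (R : realType) (T : rooted_tree)
    (X : discreteFunctionSpace R T) (D : X -> X) : Prop :=
  forall (f : X) (v : T), fbs_eval (D f) v = derivative (fbs_eval f) v.

Definition bounded_operator (R : realType) (E F : normedModType R[i])
    (L : {linear E -> F}) : Prop :=
  exists M : R, forall f : E, `|L f| <= M%:C * `|f|.

Definition point_spectrum (K : fieldType) (E : lmodType K) (L : E -> E)
    : set K :=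
  [set lambda | exists2 f : E, f != 0 & L f = lambda *: f].

(* Main.v *)
Require Import Defs.
From HB Require Import structures.
From mathcomp Require Import all_boot all_order all_algebra.
From mathcomp Require Import complex.
From mathcomp Require Import all_classical all_reals all_analysis.

Set Implicit Arguments.
Unset Strict Implicit.
Unset Printing Implicit Defensive.

Import Order.TTheory GRing.Theory Num.Theory.
Import numFieldNormedType.Exports.
Local Open Scope classical_set_scope.
Local Open Scope complex_scope.
Local Open Scope ring_scope.

(** If [D f = lambda f], then at every [v] other than the root
    [(1 - lambda) f v = f (parent v)], and [lambda f] vanishes at the root.
    - For [lambda = 0], [f] takes the same value at [v] and at its parent, so it
      is constant; hence [0] is an eigenvalue exactly when the space contains a
      nonzero constant function, and then by scaling all of them.
    - For [lambda] different from [0] and [1], [f] vanishes at the root, and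
      vanishing passes from the parent to the child, so [f = 0].
    - For [lambda = 1], [f] vanishes at every parent; there being no terminal
      vertices, every vertex is the parent of some vertex, so again [f = 0].

    The combinatorial part is thus induction from parent to child
    ([tree_parent_ind]) and the existence of children ([parent_surjective]).
    Both follow from the uniqueness of simple paths ([simple_path_unique]),
    which identifies the parent of [v] as the last vertex before [v] on the
    simple path from the root ([parent_rcons]). *)

(** * Simple paths and parents in a tree *)

(** If the first edges differed, then following the first path up to the first
    vertex [z] that it shares with the second, and returning to [a] along the
    second, would be a cycle on at least three vertices. *)
Lemma simple_path_first_edge (T : rooted_tree) (a b x y : T) (p q : seq T) :
  simple_path a (x :: p) b -> simple_path a (y :: q) b -> x = y.
Proof.
move=> [pp up lp] [pq uq lq]; apply/eqP; apply: contraT => nxy.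
have hasq : has (mem (y :: q)) (x :: p).
  apply/hasP; exists b; first by have := mem_last x p; rewrite [last _ _]lp.
  by have := mem_last y q; rewrite [last _ _]lq.
have [p1 [z [p2 [ep zq p1q]]]] : exists p1 z p2,
    [/\ x :: p = p1 ++ z :: p2, z \in y :: q & ~~ has (mem (y :: q)) p1].
  by case: (split_find hasq) => z p1 p2 zq p1q; exists p1, z, p2; rewrite cat_rcons.
have [q1 [q2 eq]] : exists q1 q2, y :: q = q1 ++ z :: q2.
  by case/splitPr: zq => q1 q2; exists q1, q2.
have hd : head z p1 != head z q1.
  have -> : head z p1 = x by case: (p1) ep => [|? ?] [].
  by have -> : head z q1 = y by case: (q1) eq => [|? ?] [].
have p1q1 : ~~ has (mem p1) q1.
  apply/hasPn => w wq1; apply: contra p1q => /= wp1.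
  by apply/hasP; exists w => //=; rewrite eq mem_cat wq1.
move: pp up; rewrite ep cat_path cons_uniq mem_cat cat_uniq /= inE.
move=> /and3P[pp1 ez _] /andP[/norP[ap1 /norP[az _]]].
move=> /and3P[up1 /norP[zp1 _] _].
move: pq uq; rewrite eq cat_path cons_uniq mem_cat cat_uniq /= inE.
move=> /and3P[pq1 ezq _] /andP[/norP[aq1 _]] /and3P[uq1 /norP[zq1 _] _].
have cyc : ucycle (@adj T) (a :: p1 ++ z :: rev q1).
  apply/andP; split.
    rewrite /= rcons_cat /= cat_path pp1 /= ez /=.
    have -> : rcons (rev q1) a = rev (belast a (rcons q1 z)).
      by rewrite belast_rcons rev_cons.
    rewrite -[z in path _ z _](last_rcons a q1 z) rev_path.
    rewrite (eq_path (e' := @adj T)); last by move=> ? ?; rewrite /= tree_sym.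
    by rewrite rcons_path pq1.
  rewrite /= mem_cat inE mem_rev (negPf ap1) (negPf az) (negPf aq1) /=.
  rewrite cat_uniq up1 /= mem_rev rev_uniq uq1 zq1 (negPf zp1) /= andbT.
  by rewrite has_rev.
have := tree_simply_connected cyc; rewrite /= size_cat /= size_rev.
by case: (p1) (q1) hd => [|x' p1'] [|y' q1'] //=; rewrite ?eqxx ?addnS.
Qed.

Lemma simple_path_unique (T : rooted_tree) (a b : T) (p q : seq T) :
  simple_path a p b -> simple_path a q b -> p = q.
Proof.
elim: p a q => [|x p IHp] a [|y q] //.
- move=> [_ _ /= <-] [_ /andP[/negP anq _] lq]; case: anq.
  by have := mem_last y q; rewrite [last _ _]lq.
- move=> [_ /andP[/negP anp _] lp] [_ _ /= eab]; case: anp.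
  by have := mem_last x p; rewrite [last _ _]lp eab.
move=> sp sq; have exy := simple_path_first_edge sp sq.
subst y; congr cons; apply: (IHp x).
- by case: sp => /andP[_ pp] /andP[_ up] lp.
- by case: sq => /andP[_ pq] /andP[_ uq] lq.
Qed.

Lemma simple_path_exists (T : rooted_tree) (u v : T) :
  exists p, simple_path u p v.
Proof.
have [p pp lp] := tree_connected u v.
by move: lp; case/shortenP: pp => q pq uq _ lq; exists q.
Qed.

Lemma is_parentE (T : rooted_tree) (v u : T) (q : seq T) :
  simple_path (Defs.root T) (rcons q v) v -> is_parent v u <-> u = last (Defs.root T) q.
Proof.
move=> sq; split=> [[euv [p sp]]|->]; last first.
  split; first by case: sq; rewrite rcons_path tree_sym => /andP[].
  by exists (rcons q v) => //; rewrite -rcons_cons mem_rcons inE mem_last orbT.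
rewrite (simple_path_unique sp sq) -rcons_cons mem_rcons inE.
case/predU1P => [uv|]; first by move: euv; rewrite uv tree_irr.
(* Cutting the path after [u] and going directly to [v] gives a second simple
   path to [v], so nothing was cut. *)
move=> uq; have [q1 [q2 [eq lq1]]] :
    exists q1 q2, q = q1 ++ q2 /\ last (Defs.root T) q1 = u.
  by case/splitPl: uq => q1 q2 lq1; exists q1, q2.
suff /(simple_path_unique sq)/rcons_inj[->] :
  simple_path (Defs.root T) (rcons q1 v) v by [].
case: sq; rewrite {}eq rcons_cat cat_path -cat_cons cat_uniq => /andP[pq1 _].
move=> /and3P[uq1 /hasPn hq2 _] _.
split; last by rewrite last_rcons.
- by rewrite rcons_path pq1 lq1 tree_sym.
- rewrite -rcons_cons rcons_uniq uq1 andbT.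
  by apply: hq2; rewrite mem_rcons mem_head.
Qed.

Lemma parent_rcons (T : rooted_tree) (v : T) (q : seq T) :
  simple_path (Defs.root T) (rcons q v) v -> parent v = last (Defs.root T) q.
Proof.
move=> sq; apply/(is_parentE _ sq).
apply: (@xgetPex _ _ [set u | is_parent v u]).
by exists (last (Defs.root T) q); apply/(is_parentE _ sq).
Qed.

Lemma tree_parent_ind (T : rooted_tree) (P : T -> Prop) :
  P (Defs.root T) -> (forall v, v != Defs.root T -> P (parent v) -> P v) ->
  forall v, P v.
Proof.
move=> P0 PS v; have [p] := simple_path_exists (Defs.root T) v.
elim/last_ind: p v => [|p w IHp] v sp; first by case: sp => _ _ <-.
have ewv : w = v by case: sp => _ _; rewrite last_rcons.
subst w; apply: PS.
  case: sp => _ /andP[+ _] _; apply: contra => /eqP <-.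
  by rewrite mem_rcons mem_head.
rewrite (parent_rcons sp); apply: IHp.
case: sp; rewrite rcons_path -rcons_cons rcons_uniq => /andP[pp _] /andP[_ up] _.
by split.
Qed.

Lemma has_neighbor (T : rooted_tree) (w : T) : exists u, adj w u.
Proof.
have [x xw] : exists x : T, x <> w.
  apply: contrapT => nx; apply: (@tree_infinite T).
  apply: (sub_finite_set _ (finite_set1 w)) => x _ /=.
  by apply: contrapT => xw; apply: nx; exists x.
have [[|u p] /= pp lp] := tree_connected w x; first by case: xw.
by exists u; case/andP: pp.
Qed.

(** A neighbor of [w] that lies on the simple path from the root to [w] is the
    parent of [w]. As [w] is not terminal, some neighbor lies off that path, and
    [w] is its parent. *)
Lemma parent_surjective (T : rooted_tree) (w : T) :
  exists2 v, v != Defs.root T & parent v = w.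
Proof.
have [p sp] := simple_path_exists (Defs.root T) w.
have [v ewv vp] : exists2 v, adj w v & v \notin Defs.root T :: p.
  apply: contrapT => nv; apply: (@tree_no_terminal T w).
  have par u : adj w u -> is_parent w u.
    move=> ewu; split=> //; exists p => //.
    by apply: contrapT => /negP up; apply: nv; exists u.
  have [u ewu] := has_neighbor w; exists u; split=> // u' ewu'.
  move: (par _ ewu) (par _ ewu') => {nv par}.
  elim/last_ind: p sp => [|p x _] sp.
    (* At the root itself the path is empty and holds no neighbor. *)
    case: sp => _ _ /= <- [e1 [q sq]].
    have -> : q = [::] by apply: (simple_path_unique sq).
    by rewrite inE => /eqP eu; rewrite eu tree_irr in e1.
  have exw : x = w by case: sp => _ _; rewrite last_rcons.
  by subst x => /(is_parentE _ sp) -> /(is_parentE _ sp) ->.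
exists v; first by apply: contra vp => /eqP ->; exact: mem_head.
case: sp => pp up lp; rewrite -lp; apply: parent_rcons.
split; last by rewrite last_rcons.
- by rewrite rcons_path pp lp.
- by rewrite -rcons_cons rcons_uniq vp.
Qed.

(** * Functional Banach spaces and eigenfunctions *)

Section Evaluation.
Context {R : realType} {Omega : Type} (X : functionalBanachSpace R Omega).

Lemma fbs_eval0 (x : Omega) : fbs_eval (0 : X) x = 0.
Proof.
have := fbs_linear 1 (0 : X) 0 x.
by rewrite scaler0 addr0 mul1r => /eqP; rewrite -subr_eq subrr eq_sym => /eqP.
Qed.

Lemma fbs_evalZ (a : R[i]) (f : X) (x : Omega) :
  fbs_eval (a *: f) x = a * fbs_eval f x.
Proof. by rewrite -[a *: f]addr0 fbs_linear fbs_eval0 addr0. Qed.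

Lemma fbs_eq0 (f : X) : (forall x, fbs_eval f x = 0) -> f = 0.
Proof. by move=> f0; apply: fbs_ext => x; rewrite fbs_eval0. Qed.

End Evaluation.

Section Eigenfunctions.
Context {R : realType} {T : rooted_tree}.
Implicit Types (f : T -> R[i]) (lambda : R[i]).

Lemma derivative_eq0_constant f :
  (forall v, derivative f v = 0) -> forall v, f v = f (Defs.root T).
Proof.
move=> f0; apply: tree_parent_ind => // v v0 <-.
by apply/eqP; rewrite -subr_eq0; have := f0 v; rewrite /derivative (negPf v0) => ->.
Qed.

Lemma eigenfunction_eq0 lambda f : lambda != 0 ->
  (forall v, derivative f v = lambda * f v) -> forall v, f v = 0.
Proof.
move=> l0 fl.
have fo : f (Defs.root T) = 0.
  have /eqP := fl (Defs.root T).
  by rewrite /derivative eqxx eq_sym mulf_eq0 (negPf l0) => /eqP.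
have fpar v : v != Defs.root T -> f (parent v) = (1 - lambda) * f v.
  move=> v0; rewrite mulrBl mul1r -fl /derivative (negPf v0).
  by rewrite opprB addrC subrK.
have [l1|l1] := eqVneq lambda 1.
  move=> w; have [v v0 <-] := parent_surjective w.
  by rewrite fpar // l1 subrr mul0r.
apply: tree_parent_ind => // v v0; rewrite fpar // => /eqP.
by rewrite mulf_eq0 subr_eq0 eq_sym (negPf l1) => /eqP.
Qed.

End Eigenfunctions.

Theorem theorem2p16 (R : realType) (T : rooted_tree)
    (X : discreteFunctionSpace R T) (D : {linear X -> X})
    (D_diff : is_differentiation D) (D_bounded : bounded_operator D) :
  point_spectrum D =
  if `[< contains_constants X >] then [set 0] else set0.
Proof.
have eigen lambda : point_spectrum D lambda ->
    lambda = 0 /\ contains_constants X.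
  move=> [f fN0 Df].
  have fl v : derivative (fbs_eval f) v = lambda * fbs_eval f v.
    by rewrite -D_diff Df fbs_evalZ.
  have l0 : lambda = 0.
    apply/eqP; apply: contraNT fN0 => l0; apply/eqP/fbs_eq0.
    exact: eigenfunction_eq0 l0 fl.
  have fc : forall v, fbs_eval f v = fbs_eval f (Defs.root T).
    by apply: derivative_eq0_constant => v; rewrite fl l0 mul0r.
  have fo : fbs_eval f (Defs.root T) != 0.
    by apply: contraNneq fN0 => fo; apply/eqP/fbs_eq0 => v; rewrite fc.
  split=> // c; exists ((c / fbs_eval f (Defs.root T)) *: f) => v.
  by rewrite fbs_evalZ fc divfK.
case: asboolP => [cX|ncX]; apply/seteqP; split=> lambda //=.
- by case/eigen.
- move=> ->; have [f f1] := cX 1; exists f.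
    by apply/eqP => f0; have /eqP := f1 (Defs.root T); rewrite f0 fbs_eval0 eq_sym oner_eq0.
  rewrite scale0r; apply: fbs_eq0 => v.
  by rewrite D_diff /derivative !f1 subrr if_same.
- by case/eigen.
Qed.
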